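(* Let $G$ be a finite group, let $n$ be a positive integer and let $L$ be a non-empty subset of $G$. If the function $f:G\longrightarrow G$ given by $f(x)=x^n$ for all $x\in G$ is a group homomorphism, then $|N_{n,L}|$ is a multiple of $\big[2^{(n, |G|)}-1\big]^{|L|}$.
   Context: For a non-empty subset $S$ of a group $G$ and a positive integer $n$, put $\mho^{\{n\}}(S)=\{s^n \mid s\in S\}$. For a non-empty subset $L$ of $G$, $N_{n,L}$ denotes the set of all non-empty subsets $S\subseteq G$ such that $\mho^{\{n\}}(S)=L$. For positive integers $a,b$, $(a,b)$ denotes their greatest common divisor. The number $0$ counts as a multiple of every integer. *)

(* Defs.v *)
From mathcomp Require Import all_boot all_fingroup.

Set Implicit Arguments.
Unset Strict Implicit.
Unset Printing Implicit Defensive.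

Local Open Scope group_scope.

(* The set of n-th powers of the elements of S. This is the bare image set,
   not the subgroup 'Mho^n(G) of the library. *)
Definition power_set (gT : finGroupType) (n : nat) (S : {set gT}) : {set gT} :=
  [set s ^+ n | s in S].

(* The set N_{n,L} of the group G. *)
Definition power_preimages (gT : finGroupType) (G : {group gT}) (n : nat)
    (L : {set gT}) : {set {set gT}} :=
  [set S : {set gT} | [&& S != set0, S \subset G & power_set n S == L]].

(* Main.v *)
(* A set S with image L under a map amounts to a choice, for each l in L, of a
   non-empty subset of the fiber over l. The fibers of the power homomorphism
   over its image are cosets of its kernel 'Ldiv_n(G), whose order is a multiple
   of gcd(n, |G|) by Frobenius' theorem, and 2 ^ d - 1 divides 2 ^ k - 1 as soon
   as d divides k. An empty fiber contributes a factor 0. *)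
Require Import Defs.
From mathcomp Require Import all_boot all_fingroup all_solvable.

Set Implicit Arguments.
Unset Strict Implicit.
Unset Printing Implicit Defensive.

Lemma card_imset_preimages (aT rT : finType) (f : aT -> rT) (A : {set aT})
    (L : {set rT}) :
  #|[set S : {set aT} | (S \subset A) && (f @: S == L)]|
  = \prod_(l in L) (2 ^ #|A :&: f @^-1: [set l]| - 1).
Proof.
pose F l := [set B : {set aT} | (B != set0) && (B \subset A :&: f @^-1: [set l])].
pose slice (S : {set aT}) := [ffun l => S :&: f @^-1: [set l]].
have cardF l : #|F l| = 2 ^ #|A :&: f @^-1: [set l]| - 1.
  rewrite -card_powerset (cardsD1 set0 (powerset _)) inE sub0set add1n subn1 /=.
  by apply: eq_card => B; rewrite !inE.
under eq_bigr do rewrite -cardF -sum1_card.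
(* Expanding the product leaves one term for each choice function in the [pfamily]. Its default
   [set0] outside [L] agrees with the empty slices there. *)
rewrite (big_distr_big_dep set0) /=.
under eq_bigr do rewrite big1 //.
rewrite sum1_card -(card_in_imset (f := slice)).
  apply: eq_card => g; apply/imsetP/pfamilyP => [[S] | [supp_g gF]].
    rewrite inE => /andP[sSA /eqP <-] ->; split=> [|l /imsetP[x Sx ->]].
      apply/supportP => l l_fS; rewrite ffunE; apply/setP=> x; rewrite !inE.
      by apply: contraNF l_fS => /andP[Sx /eqP <-]; apply: imset_f.
    by rewrite ffunE inE setSI // andbT; apply/set0Pn; exists x; rewrite !inE Sx /=.
  have gE l x : x \in g l -> [/\ l \in L, x \in A & f x = l].
    have [Ll | notLl] := boolP (l \in L); last first.
      by rewrite (supportP supp_g) // inE.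
    have := gF l Ll; rewrite inE => /andP[_ /subsetP sgl] /sgl.
    by rewrite !inE => /andP[Ax /eqP].
  (* By [gE] the sets [g l] lie in distinct fibers, so slicing their union gives back [g]. *)
  exists (\bigcup_l g l).
    rewrite inE; apply/andP; split.
      by apply/bigcupsP => l _; apply/subsetP => x /gE[].
    apply/eqP/setP=> l; apply/imsetP/idP=> [[x /bigcupP[m _ /gE[Lm _ fx]] ->] | Ll].
      by rewrite fx.
    have := gF l Ll; rewrite inE => /andP[/set0Pn[x gx] _].
    by exists x; [apply/bigcupP; exists l | case/gE: gx].
  apply/ffunP=> l; rewrite ffunE; apply/setP=> x; rewrite !inE.
  apply/idP/andP=> [gx | [/bigcupP[m _ gx] /eqP <-]].
    by split; [apply/bigcupP; exists l | case/gE: gx => _ _ /eqP].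
  by case/gE: (gx) => _ _ ->.
(* Injectivity of [slice]: whether [x] lies in [S] is read off the slice at [f x]. *)
move=> S T _ _ /ffunP eqST; apply/setP=> x.
by have /setP/(_ x) := eqST (f x); rewrite !ffunE !inE eqxx !andbT.
Qed.

Lemma dvdn_pred_exp (b d k : nat) : d %| k -> b ^ d - 1 %| b ^ k - 1.
Proof. by case/dvdnP=> q ->; rewrite mulnC expnM !subn1 dvdn_pred_predX. Qed.

Lemma dvdn_gcd_card_Ldiv (gT : finGroupType) (G : {group gT}) (n : nat) :
  gcdn n #|G| %| #|'Ldiv_n(G)%g|.
Proof.
(* Frobenius' theorem is stated for exponents dividing the group order. Orders of elements divide
   [#|G|], so passing to the gcd keeps the same solutions. *)
have ->: 'Ldiv_n(G)%g = 'Ldiv_(gcdn n #|G|)(G)%g.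
  apply/setP=> x; rewrite !inE; case: (boolP (x \in G)) => //= Gx.
  by rewrite -!order_dvdn dvdn_gcd order_dvdG ?andbT.
exact: Frobenius_Ldiv (dvdn_gcdr _ _).
Qed.

(** By [powM], [y ^+ n = x ^+ n] amounts to [(x^-1 * y) ^+ n = 1], and left translation by [x]
    preserves cardinality. *)
Lemma card_power_fiber (gT : finGroupType) (G : {group gT}) (n : nat) (x : gT)
    (powM : {in G &, {morph (fun x : gT => (x ^+ n)%g) : x y / (x * y)%g}}) :
  x \in G ->
  #|G :&: (fun y => (y ^+ n)%g) @^-1: [set (x ^+ n)%g]| = #|'Ldiv_n(G)%g|.
Proof.
move=> Gx; rewrite -(card_lcoset 'Ldiv_n(G)%g x); apply: eq_card => y.
rewrite mem_lcoset !inE groupMl ?groupV //; case: (boolP (y \in G)) => //= Gy.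
by rewrite powM ?groupV //= expgVn -eq_mulVg1 eq_sym.
Qed.

Theorem corollary2p5 (gT : finGroupType) (G : {group gT}) (n : nat)
    (L : {set gT}) (n_gt0 : (0 < n)%N) (L_neq0 : L != set0)
    (sLG : L \subset G)
    (powM : {in G &, {morph (fun x : gT => (x ^+ n)%g) : x y / (x * y)%g}}) :
  ((2 ^ gcdn n #|G| - 1) ^ #|L| %| #|power_preimages G n L|)%N.
Proof.
pose f (x : gT) := (x ^+ n)%g.
have ->: power_preimages G n L
       = [set S : {set gT} | (S \subset G) && (f @: S == L)].
  apply/setP=> S; rewrite !inE; case: eqP => //= ->.
  by rewrite imset0 eq_sym (negPf L_neq0) andbF.
rewrite card_imset_preimages -prod_nat_const.
(* Both sides are now products over [L], so divisibility is checked factor by factor. *)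
apply: (big_ind2 (fun a b => a %| b)) => // [? ? ? ?|l _]; first exact: dvdn_mul.
apply: dvdn_pred_exp.
have [->|[x]] := set_0Vmem (G :&: f @^-1: [set l]); first by rewrite cards0.
rewrite !inE => /andP[Gx /eqP <-].
by rewrite card_power_fiber ?dvdn_gcd_card_Ldiv.
Qed.
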